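(* Consider a causal bandit instance on a general causal graph with finite intervention set $\mathcal{A}$ and reward variable $Y\in\{0,1\}$ with $n$ parents each taking values in a set $S\subset\mathbb{R}$, $|S|=k$, such that the distributions $\mathbb{P}(Pa(Y)=\cdot\mid do(a))$, $a\in\mathcal{A}$, are known to the algorithm and all have the same support. Let $c_{\mathbf{y}}=\min_{a\in\mathcal{A}}\mathbb{P}(Pa(Y)=\mathbf{y}\mid do(a))$ for $\mathbf y\in S^n$, $\zeta_a=\sum_{\mathbf{y}:c_{\mathbf{y}}>0}\frac{\mathbb{P}(Pa(Y)=\mathbf{y}\mid do(a))}{c_{\mathbf{y}}}$, $\Delta_a=\max_{b\in\mathcal{A}}\mu_b-\mu_a$, $\delta=\min\{c_{\mathbf{y}}:\mathbf{y}\in S^n,\ c_{\mathbf{y}}>0\}$, $$L_1=\min\Big\{t\in\mathbb{N}: t\ge\frac{2\log(k^nt^2)}{\delta^2}\Big\},\qquad L_{2,a}=\min\Big\{t\in\mathbb{N}: t\ge\frac{4\log(k^nt^2/2)}{\Delta_a^2}\zeta_a^2\Big\},$$ and $L_a=\max\{L_1,L_{2,a}\}$. Then the expected cumulative regret of the algorithm C-UCB-2 (defined in the context) after $T$ rounds is at most $$\sum_{a\in\mathcal{A}}\Delta_a\Big(L_a+\frac{2\pi^2}{3}\Big),$$ where terms with $\Delta_a=0$ are interpreted as $0$.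
   Context: Setting. A causal Bayesian network is a directed acyclic graph $\mathcal{G}$ whose nodes are random variables with finite ranges, with a joint distribution $\mathbb{P}$ factorizing over $\mathcal{G}$. An intervention $a=do(\mathbf{X}=\mathbf{x})$ removes all edges into the nodes of $\mathbf{X}$ and sets $\mathbf{X}=\mathbf{x}$; the resulting distribution is denoted $\mathbb{P}(\cdot\mid do(a))$ (the empty intervention is allowed). $Y\in\{0,1\}$ is a designated reward node, not intervened upon, with parents $Pa(Y)=(Y_1,\dots,Y_n)$, each with values in $S$; realizations of $Pa(Y)$ are vectors $\mathbf{y}\in S^n$. The conditional law of $Y$ given $Pa(Y)=\mathbf{y}$ is the same under every intervention; write $\mu_{\mathbf{y}}=E[Y\mid Pa(Y)=\mathbf{y}]$, so the expected reward of $a\in\mathcal{A}$ is $\mu_a=\sum_{\mathbf{y}\in S^n}\mu_{\mathbf{y}}\,\mathbb{P}(Pa(Y)=\mathbf{y}\mid do(a))$. The values $\mu_{\mathbf y}$ are unknown to the algorithm. In round $t$ the algorithm plays $a_t\in\mathcal{A}$ (based on the past) and observes a fresh sample $(Pa_t(Y),Y_t)$ from $\mathbb{P}(\cdot\mid do(a_t))$. The expected cumulative regret after $T$ rounds is $E\big[T\max_{a\in\mathcal{A}}\mu_a-\sum_{t=1}^T\mu_{a_t}\big]$. Algorithm C-UCB-2. Let $N_{\mathbf{y},t}=\sum_{s=1}^t\mathbb{1}\{Pa_s(Y)=\mathbf{y}\}$; $\widehat\mu_{\mathbf{y}}(t)=\frac{1}{N_{\mathbf{y},t}}\sum_{s=1}^tY_s\mathbb{1}\{Pa_s(Y)=\mathbf{y}\}$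 if $N_{\mathbf{y},t}\ge1$ and $\widehat\mu_{\mathbf{y}}(t)=0$ otherwise; $\widehat\mu_a(t)=\sum_{\mathbf{y}\in S^n}\widehat\mu_{\mathbf{y}}(t)\,\mathbb{P}(Pa(Y)=\mathbf{y}\mid do(a))$; $\overline\mu_a(t)=\widehat\mu_a(t)+\sqrt{\frac{\log(k^nt^2/2)}{t}}\,\zeta_a$. In the first $|\mathcal{A}|$ rounds each intervention is played once; in every round $t>|\mathcal{A}|$ the algorithm plays $a_t\in\arg\max_{a\in\mathcal{A}}\overline\mu_a(t-1)$. Logarithms are natural.
   Formalization: The minimum defining L_{2,a} is taken only over t ≥ 1 with k^n t^2 > 2; this changes the bound only when k^n = 2, where t = 1 literally gives L_{2,a} = 1 for every gap and the stated regret bound is false. *)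

(* Defs.v *)
From HB Require Import structures.
From mathcomp Require Import all_boot all_order all_algebra.
From mathcomp Require Import finmap.
From mathcomp Require Import boolp reals exp trigo.

Set Implicit Arguments.
Unset Strict Implicit.
Unset Printing Implicit Defensive.

Import Order.TTheory GRing.Theory Num.Theory.

Local Open Scope ring_scope.

(* The variable v takes its values in the finite set of reals rng v, and     *)
(* cpt x w = P(v = w | Pa(v) = x|_Pa(v)) is a transition kernel, so it is    *)
(* also specified at parent configurations of observational probability 0,   *)
(* which an intervention may make possible.                                  *)
Record causal_network (R : realType) := CausalNetwork {
  node : finType;
  edge : rel node;
  acyclic : forall u v, edge u v -> ~~ connect edge v u;
  rng : node -> {fset R};
  rng_neq0 : forall v, rng v != fset0;
  cpt : forall v, {dffun forall u : node, rng u} -> rng v -> R;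
  cpt_ge0 : forall v x (w : rng v), 0 <= cpt x w;
  cpt_sum1 : forall v x, \sum_(w : rng v) cpt x w = 1;
  cpt_local : forall v (x x' : {dffun forall u : node, rng u}),
    (forall u, edge u v -> x u = x' u) ->
    forall w : rng v, cpt x w = cpt x' w
}.

Section Interventions.
Variables (R : realType) (M : causal_network R).

Definition assignment : finType := {dffun forall v : node M, rng v}.

(* a v = Some w when a sets v to w, a v = None when v is not intervened on. *)
Definition intervention : finType :=
  {dffun forall v : node M, option (rng v)}.

(* The truncated factorization: P(x | do(a)); the empty intervention gives   *)
(* the joint law, factorizing over the graph.                                *)
Definition do_prob (a : intervention) (x : assignment) : R :=
  \prod_(v : node M)
    (if a v is Some w then (x v == w)%:R else cpt x (x v)).

End Interventions.

Record causal_bandit (R : realType) := CausalBandit {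
  net :> causal_network R;
  reward : node net;
  reward_rng : rng reward = [fset 0; 1]%fset;
  npar : nat;
  par : npar.-tuple (node net);
  par_uniq : uniq par;
  par_edge : forall v, (v \in par) = edge v reward;
  pvals : {fset R};
  par_rng : forall v, v \in par -> (rng v `<=` pvals)%fset;
  arms : {set intervention net};
  arms_neq0 : arms != set0;
  arms_reward : forall a, a \in arms -> a reward = None
}.

Section CausalBandit.
Variables (R : realType) (B : causal_bandit R).

Local Notation n := (npar B).
Local Notation k := (#|` pvals B|).
Local Notation A := (arms B).
Local Notation arm := (intervention B).

Definition pavec : finType := {ffun 'I_n -> pvals B}.

Definition pa_eq (x : assignment B) (y : pavec) : bool :=
  [forall i : 'I_n, val (x (tnth (par B) i)) == val (y i)].

Definition pa_prob (a : arm) (y : pavec) : R :=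
  \sum_(x : assignment B | pa_eq x y) do_prob a x.

(* P(Pa(Y) = y, Y = b | do(a)) *)
Definition obs_prob (a : arm) (y : pavec) (b : bool) : R :=
  \sum_(x : assignment B | pa_eq x y && (val (x (reward B)) == b%:R))
     do_prob a x.

(* E[Y | Pa(Y) = y], read off the kernel of Y (which depends on x only       *)
(* through the values of the parents). Vectors y outside the product of the  *)
(* ranges of the parents always have probability 0; they get the value 0.    *)
Definition mu_pa (y : pavec) : R :=
  if [pick x : assignment B | pa_eq x y] is Some x
  then \sum_(w : rng (reward B)) val w * cpt x w
  else 0.

Definition mu (a : arm) : R := \sum_(y : pavec) mu_pa y * pa_prob a y.

(* The neutral elements in the extrema below are harmless: A is nonempty,    *)
(* 0 <= mu a, and the quantities that are minimized are probabilities.       *)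
Definition mu_max : R := \big[Num.max/0]_(b in A) mu b.

Definition Delta (a : arm) : R := mu_max - mu a.

Definition same_support : Prop :=
  forall a b, a \in A -> b \in A ->
  forall y, (0 < pa_prob a y) = (0 < pa_prob b y).

Definition cmin (y : pavec) : R := \big[Num.min/1]_(a in A) pa_prob a y.

Definition zeta (a : arm) : R :=
  \sum_(y : pavec | 0 < cmin y) pa_prob a y / cmin y.

Definition delta : R := \big[Num.min/1]_(y : pavec | 0 < cmin y) cmin y.

(* The least t >= 1 such that p t (0 if there is none). *)
Definition first_pos (p : pred nat) : nat :=
  match pselect (exists t, (0 < t)%N && p t) with
  | left ex => ex_minn ex
  | right _ => 0%N
  end.

Definition L1 : nat :=
  first_pos (fun t => 2 * ln ((k ^ n)%:R * t%:R ^+ 2) / delta ^+ 2 <= t%:R).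

Definition L2_cond (a : arm) (t : nat) : bool :=
  4 * ln ((k ^ n)%:R * t%:R ^+ 2 / 2) / Delta a ^+ 2 * zeta a ^+ 2 <= t%:R.

(* The minimum is over the t with log(k^n t^2/2) > 0, i.e. with a positive   *)
(* confidence radius. This only excludes t = 1, and only when k^n <= 2 (see  *)
(* L2_literal). If k^n = 2 then t = 1 satisfies L2_cond whatever the gap,    *)
(* because log(k^n/2) = 0, and the regret bound would be false. If k^n <= 1  *)
(* then all the gaps are 0.                                                  *)
Definition L2 (a : arm) : nat :=
  first_pos (fun t => (2 < k ^ n * t ^ 2)%N && L2_cond a t).

Lemma L2_literal a : (2 < k ^ n)%N -> L2 a = first_pos (L2_cond a).
Proof.
move=> kn; have E : (fun t => (0 < t) && ((2 < k ^ n * t ^ 2) && L2_cond a t))%N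
    =1 (fun t => (0 < t)%N && L2_cond a t).
  case=> [//|t] /=.
  by rewrite (leq_trans kn) // leq_pmulr // expn_gt0.
rewrite /L2 /first_pos; case: pselect => [e1|ne]; case: pselect => [e2|ne2] //.
- exact: eq_ex_minn.
- by case: ne2; case: e1 => t; rewrite E => ?; exists t.
- by case: ne; case: e2 => t; rewrite -E => ?; exists t.
Qed.

Definition L (a : arm) : nat := maxn L1 (L2 a).

(* A round is (a_t, Pa_t(Y), Y_t); a history lists the rounds, oldest first. *)
Definition round : finType := (arm * pavec * bool)%type.
Definition r_arm (r : round) : arm := r.1.1.
Definition r_pa (r : round) : pavec := r.1.2.
Definition r_rew (r : round) : bool := r.2.

Definition nobs (h : seq round) (y : pavec) : nat :=
  count (fun r => r_pa r == y) h.

Definition mu_pa_hat (h : seq round) (y : pavec) : R :=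
  if (1 <= nobs h y)%N
  then (\sum_(r <- h) (r_rew r)%:R * (r_pa r == y)%:R) / (nobs h y)%:R
  else 0.

Definition mu_hat (h : seq round) (a : arm) : R :=
  \sum_(y : pavec) mu_pa_hat h y * pa_prob a y.

Definition ucb (h : seq round) (a : arm) : R :=
  let t : R := (size h)%:R in
  mu_hat h a + Num.sqrt (ln ((k ^ n)%:R * t ^+ 2 / 2) / t) * zeta a.

(* pol h a = probability of playing a after the history h; deterministic     *)
(* algorithms are the {0,1}-valued policies.                                 *)
Definition policy := seq round -> arm -> R.

Definition is_policy (pol : policy) : Prop :=
  forall h, [/\ forall a, 0 <= pol h a,
                forall a, a \notin A -> pol h a = 0
              & \sum_(a in A) pol h a = 1].

(* The order of the initial rounds and the tie-breaking rule are arbitrary,  *)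
(* and may depend on the history and be randomized.                          *)
Definition is_CUCB2 (pol : policy) : Prop :=
  is_policy pol /\
  forall h a, 0 < pol h a ->
    if (size h < #|A|)%N then a \notin [seq r_arm r | r <- h]
    else [forall b in A, ucb h b <= ucb h a].

Definition history_prob (pol : policy) (T : nat) (h : T.-tuple round) : R :=
  \prod_(t < T) (let r := tnth h t in
     pol (take t h) (r_arm r) * obs_prob (r_arm r) (r_pa r) (r_rew r)).

Definition expected_regret (pol : policy) (T : nat) : R :=
  \sum_(h : T.-tuple round)
     history_prob pol h *
     (T%:R * mu_max - \sum_(t < T) mu (r_arm (tnth h t))).

End CausalBandit.

(* Main.v *)
Require Import Defs.
From HB Require Import structures.
From mathcomp Require Import all_boot all_order all_algebra.
From mathcomp Require Import finmap.
From mathcomp Require Import boolp reals.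
From mathcomp Require Import topology normedtype sequences derive realfun exp trigo.
From mathcomp Require Import ring lra zify.

(* Once s is at least L2 a, the confidence radius                            *)
(* r = sqrt (log (k^n s^2 / 2) / s) satisfies 2 r zeta_a <= Delta_a, so      *)
(* playing the suboptimal arm a after s rounds forces |mu_hat_y - mu_y| to   *)
(* be at least x = r / c_y for some y with c_y > 0. Let N be the number of   *)
(* rounds so far with Pa(Y) = y. The bad event for y says that               *)
(* exp (4 x (N (mu_hat_y - mu_y)) - 4 x^2 N), or its mirror image, is at     *)
(* least 1. By Hoeffding's lemma each round multiplies the expectation of    *)
(* this process by at most 1 - c_y (1 - exp (- 2 x^2)) <= 1 - c_y^2 x^2,     *)
(* because y is observed with conditional probability at least c_y. This     *)
(* accounts for the random N and the adaptive choice of arms at once, and    *)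
(* gives probability at most 2 exp (- s r^2) = 4 / (k^n s^2). Summed over y  *)
(* this is 4 / s^2, and the condition defining L2 a forces L2 a >= 8, so     *)
(* the sum over s is at most 1 <= 2 pi^2 / 3.                                *)

(** The regret equals the sum over arms of [Delta a] times the number of plays of [a]
    ([regret_plays]), so it suffices to bound each expected number of plays by [L a + 1]
    ([expect_plays]). Up to round max(L_a, |A|) there are at most [L a] plays, since each arm is
    played only once in the initial phase. After that, optimism makes the probability of playing a
    suboptimal arm at most the number of badly estimated vectors y ([pol_le_bad]), whose expectation
    is summable ([expect_bad]).

    The causal structure enters through [obs_probE]: given Pa(Y) = y, the reward is Bernoulli with
    mean [mu_pa y] under every arm, so samples from different arms can be pooled. Expectations over
    histories are iterates of the one-round operator [step]. The concentration bound combines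
    [hoeffding_bernoulli] with the supermartingale estimate [step_weight], giving [deviates_tail].
    By [log_half_monotone], the condition defining [L2] persists at all later times. *)

Set Implicit Arguments.
Unset Strict Implicit.
Unset Printing Implicit Defensive.

Import Order.TTheory GRing.Theory Num.Theory.

Local Open Scope ring_scope.

(** * Summation over assignments of a causal network *)

Section Resampling.
Variables (I : finType) (X : I -> finType).
Implicit Types x : {dffun forall i, X i}.

Definition upd x u (w : X u) : {dffun forall i, X i} :=
  [ffun v => dfwith x w v].

Lemma upd_in x u (w : X u) : upd x w u = w.
Proof. by rewrite ffunE dfwith_in. Qed.

Lemma upd_out x u (w : X u) v : u != v -> upd x w v = x v.
Proof. by move=> uv; rewrite ffunE dfwith_out. Qed.

Lemma upd_upd x u (w w' : X u) : upd (upd x w) w' = upd x w'.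
Proof.
apply/ffunP => v; have [<-|uv] := eqVneq u v; first by rewrite !upd_in.
by rewrite !upd_out.
Qed.

Lemma upd_id x u : upd x (x u) = x.
Proof.
apply/ffunP => v; have [<-|uv] := eqVneq u v; first by rewrite upd_in.
by rewrite upd_out.
Qed.

(** Exchanging w with the u-coordinate of x is an involution on pairs (x, w); after it the summand
    no longer depends on w. *)
Lemma sum_upd (R : realType) u (F : {dffun forall i, X i} -> R) :
  \sum_x \sum_(w : X u) F (upd x w) = #|X u|%:R * \sum_x F x.
Proof.
rewrite pair_big /=.
pose phi (p : {dffun forall i, X i} * X u) := (upd p.1 p.2, p.1 u).
have phiK : involutive phi.
  by case=> x w; rewrite /phi /= upd_in upd_upd upd_id.
rewrite (reindex_inj (inv_inj phiK)) /=.
under eq_bigr do rewrite upd_upd upd_id.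
rewrite -(pair_big xpredT xpredT (fun x _ => F x)) /= mulr_sumr.
by apply: eq_bigr => x _; rewrite sumr_const mulr_natl.
Qed.

(** Totals may be compared fibre by fibre, resampling the single coordinate u. *)
Lemma eq_sum_upd (R : realType) u (F G : {dffun forall i, X i} -> R) :
  (forall x, \sum_(w : X u) F (upd x w) = \sum_(w : X u) G (upd x w)) ->
  \sum_x F x = \sum_x G x.
Proof.
move=> FG; have [u0|u0] := eqVneq #|X u| 0%N.
  apply: eq_bigr => x _; have := card0_eq u0 (x u); by rewrite inE.
apply: (@mulfI _ #|X u|%:R); first by rewrite pnatr_eq0.
by rewrite -!sum_upd; apply: eq_bigr => x _; exact: FG.
Qed.

End Resampling.

Section Network.
Variables (R : realType) (M : causal_network R).
(** The kernels are abstract so that the results apply to an intervened network, where some kernels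
    become point masses. *)
Variable q : forall v : node M, assignment M -> rng v -> R.
Hypothesis q_sum1 : forall v x, \sum_(w : rng v) q x w = 1.
Hypothesis q_local : forall v (x x' : assignment M),
  (forall u, edge u v -> x u = x' u) -> forall w : rng v, q x w = q x' w.

Lemma edge_irrefl (u : node M) : edge u u = false.
Proof. by apply/negP => uu; have := acyclic uu; rewrite connect0. Qed.

Lemma q_upd v u (x : assignment M) (w : rng u) (w' : rng v) :
  ~~ edge u v -> q (upd x w) w' = q x w'.
Proof.
move=> uv; apply: q_local => z zv; rewrite upd_out //.
by apply: contraNneq uv => ->.
Qed.

Definition unif (D : {set node M}) v (x : assignment M) : R :=
  if v \in D then #|{: rng v}|%:R^-1 else q x (x v).

Lemma card_rng_neq0 (v : node M) : #|{: rng v}|%:R != 0 :> R.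
Proof.
rewrite pnatr_eq0 -lt0n; have /fset0Pn [w wv] := rng_neq0 v.
by apply/card_gt0P; exists [` wv]%fset.
Qed.

(** Take u in D with the fewest ancestors: by acyclicity, a predecessor of u has strictly fewer. *)
Lemma exists_source (D : {set node M}) : D != set0 ->
  exists2 u, u \in D & forall v, v \in D -> ~~ edge v u.
Proof.
case/set0Pn => u0 u0D.
pose anc u := #|[set v | connect (@edge _ M) v u]|.
exists [arg min_(u < u0 in D) anc u]; first by case: arg_minnP.
case: arg_minnP => // u uD umin v vD; apply/negP => vu.
have := umin _ vD; rewrite leqNgt => /negP; apply.
apply: proper_card; apply/properP; split.
  apply/subsetP => w; rewrite !inE => wv.
  exact: connect_trans wv (connect1 vu).
by exists u; rewrite inE ?connect0 // (acyclic vu).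
Qed.

(* The factors of a successor-closed set are normalized away by peeling off  *)
(* its sources one at a time: with the rest of the set gone, a source only   *)
(* occurs in its own factor.                                                 *)
Lemma sum_unif (D : {set node M}) (g : assignment M -> R) :
  (forall u v, edge u v -> u \in D -> v \in D) ->
  (forall x u (w : rng u), u \in D -> g (upd x w) = g x) ->
  \sum_x g x * \prod_v q x (x v) = \sum_x g x * \prod_v unif D v x.
Proof.
move: {2}#|D| (leqnn #|D|) => m; elim: m D => [|m IH] D.
  rewrite leqn0 cards_eq0 => /eqP -> _ _.
  by apply: eq_bigr => x _; congr (_ * _); apply: eq_bigr => v _; rewrite /unif inE.
move=> Dm Dcl gD; have [D0|/exists_source [u uD usrc]] := eqVneq D set0.
  by apply: IH => //; rewrite D0 cards0.
have cD' : (#|D :\ u| <= m)%N by move: Dm; rewrite (cardsD1 u D) uD.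
rewrite (IH (D :\ u)) //; last 2 first.
- move=> v w vw; rewrite !inE => /andP [vu vD]; rewrite (Dcl _ _ vw vD) andbT.
  by apply: contraTneq vw => ->; apply: usrc.
- by move=> x v w; rewrite !inE => /andP [_]; apply: gD.
apply: (@eq_sum_upd _ _ _ u) => x.
rewrite (eq_bigr (fun w => q x w * (g x * \prod_(v | v != u) unif D v x))); last first.
  move=> w _; rewrite gD // (bigD1 u) //= {1}/unif !inE eqxx /= upd_in.
  rewrite q_upd ?edge_irrefl // mulrCA; congr (_ * (_ * _)).
  apply: eq_bigr => v vu; rewrite /unif !inE vu /=; case: ifPn => // vD.
  rewrite q_upd ?upd_out 1?eq_sym //.
  by apply: contra vD => /Dcl; apply.
rewrite -mulr_suml q_sum1 mul1r.
rewrite [RHS](eq_bigr (fun w => #|{: rng u}|%:R^-1 * (g x * \prod_(v | v != u) unif D v x))).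
  by rewrite sumr_const -mulrnAl -mulr_natr mulVf ?mul1r // card_rng_neq0.
move=> w _; rewrite gD // (bigD1 u) //= {1}/unif uD mulrCA; congr (_ * (_ * _)).
apply: eq_bigr => v vu; rewrite /unif; case: ifPn => // vD.
rewrite q_upd ?upd_out 1?eq_sym //.
by apply: contra vD => /Dcl; apply.
Qed.

(** With D the set of all nodes, every factor becomes uniform and the sum is a count of
    assignments. *)
Lemma sum_prod_kernel : \sum_x \prod_v q x (x v) = 1.
Proof.
have := @sum_unif [set: node M] (fun=> 1).
under eq_bigr do rewrite mul1r.
move=> ->; [|by move=> *; rewrite inE|by []].
rewrite (eq_bigr (fun=> \prod_(v : node M) #|{: rng v}|%:R^-1)); last first.
  by move=> x _; rewrite mul1r; apply: eq_bigr => v _; rewrite /unif inE.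
rewrite sumr_const card_dep_ffun -mulr_natr.
have -> : foldr muln 1%N [seq #|{: rng v}| | v : node M] = (\prod_(v : node M) #|{: rng v}|)%N.
  by rewrite foldrE big_image.
by rewrite prodfV natr_prod mulVf //; apply/prodf_neq0 => v _; exact: card_rng_neq0.
Qed.

(* [g] does not depend on the descendants of [u], which can be summed out    *)
(* before [u].                                                               *)
Lemma sum_node_kernel u (g : assignment M -> R) (P : pred (rng u)) (m : R) :
  (forall x v (w : rng v), (v == u) || connect (@edge _ M) u v ->
     g (upd x w) = g x) ->
  (forall x, g x != 0 -> \sum_(w : rng u | P w) q x w = m) ->
  \sum_(x : assignment M | P (x u)) g x * \prod_v q x (x v) =
  m * \sum_x g x * \prod_v q x (x v).
Proof.
move=> gloc gm.
pose D := [set v | (v != u) && connect (@edge _ M) u v].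
have Dcl v w : edge v w -> v \in D -> w \in D.
  rewrite !inE => vw /andP [vu uv]; rewrite (connect_trans uv (connect1 vw)) andbT.
  by apply: contraTneq uv => <-; exact: acyclic.
have DP v : v \in D -> v != u by rewrite inE => /andP [].
have gD x v (w : rng v) : v \in D -> g (upd x w) = g x.
  by rewrite inE => /andP [_ uv]; apply: gloc; rewrite uv orbT.
rewrite big_mkcond /=.
rewrite (eq_bigr (fun x : assignment M => ((P (x u))%:R * g x) * \prod_v q x (x v))); last first.
  by move=> x _; case: ifP; rewrite ?mul1r // !mul0r.
rewrite (sum_unif Dcl) /=; last first.
  by move=> x v w vD; rewrite gD // upd_out // DP.
rewrite (sum_unif Dcl) // mulr_sumr.
apply: (@eq_sum_upd _ _ _ u) => x.
have rest (w : rng u) :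
    \prod_(v | v != u) unif D v (upd x w) = \prod_(v | v != u) unif D v x.
  apply: eq_bigr => v vu; rewrite /unif; case: ifPn => // vD.
  rewrite q_upd ?upd_out 1?eq_sym //; apply: contra vD => uv.
  by rewrite inE vu connect1.
have self (w : rng u) : unif D u (upd x w) = q x w.
  by rewrite /unif inE eqxx /= upd_in q_upd // edge_irrefl.
(* The kernel sum is known to be m only where g does not vanish; elsewhere both sides are 0. *)
have [g0|g0] := eqVneq (g x) 0.
  by rewrite !big1 // => w _; rewrite gloc ?eqxx // g0 ?mulr0 ?mul0r ?mulr0.
pose r := g x * \prod_(v | v != u) unif D v x.
rewrite (eq_bigr (fun w => (P w)%:R * q x w * r)); last first.
  move=> w _; rewrite gloc ?eqxx // (bigD1 u) //= self rest upd_in /r; ring.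
rewrite [RHS](eq_bigr (fun w => q x w * (m * r))); last first.
  move=> w _; rewrite gloc ?eqxx // (bigD1 u) //= self rest /r; ring.
rewrite -!mulr_suml q_sum1 mul1r -(gm _ g0) [in RHS]big_mkcond /=; congr (_ * _).
by apply: eq_bigr => w _; case: ifP; rewrite ?mul1r ?mul0r.
Qed.

End Network.

(** * Hoeffding's lemma for a Bernoulli variable *)

Section Hoeffding.
Import numFieldNormedType.Exports.
Variable R : realType.

Lemma le_of_derive_ge0 (f df : R -> R) :
  (forall x : R, is_derive x (1:R) f (df x)) -> (forall x, 0 < x -> 0 <= df x) ->
  forall x, 0 <= x -> f 0 <= f x.
Proof.
move=> fdf df0 x x0; apply: (@ger0_derive1_ndecry R f 0) => //.
- move=> y; rewrite in_itv/= andbT => y0; have [_ dy] := fdf y.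
  by rewrite derive1E dy; exact: df0.
- by apply: derivable_within_continuous => y _; exact: ex_derive.
Qed.

(** With D the moment generating function, F(s) = s^2/8 + s p - ln D(s) vanishes at 0 and has
    derivative S(s) - (1 - p). This is nonnegative because S starts at 1 - p and is
    nondecreasing. *)
Lemma hoeffding_bernoulli_ge0 (p t : R) : 0 <= p <= 1 -> 0 <= t ->
  p * expR (t * (1 - p)) + (1 - p) * expR (- (t * p)) <= expR (t ^+ 2 / 8).
Proof.
move=> /andP [p0 p1] t0.
pose D (s : R) := 1 - p + p * expR s.
have D0 s : 0 < D s.
  rewrite /D; have := expR_gt0 s; have [->|pN1] := eqVneq p 1.
    by move=> ?; lra.
  have {}p1 : p < 1 by rewrite lt_neqAle pN1.
  by move=> s0; have := mulr_ge0 p0 (ltW s0); lra.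
have dD (s : R) : is_derive s 1 D (p * expR s).
  by rewrite /D; apply: is_derive_eq; rewrite /GRing.scale /=; ring.
pose S (s : R) := s / 4 + (1 - p) * (D s)^-1.
have dS (s : R) : is_derive s 1 S (1 / 4 - (1 - p) * p * expR s / D s ^+ 2).
  rewrite /S; have Ds := lt0r_neq0 (D0 s).
  have dV := @is_deriveV R D s (p * expR s) 1 Ds (dD s).
  apply: is_derive_eq; rewrite /GRing.scale /=; field; exact: Ds.
have S0 s : 0 < s -> 1 - p <= S s.
  move=> s0; have : S 0 <= S s.
    apply: (le_of_derive_ge0 dS _ (ltW s0)) => x x0.
     rewrite subr_ge0 ler_pdivrMr ?exprn_gt0 //.
    (* The inequality 4 (1 - p) p e^x <= D(x)^2 is AM-GM: a variance on {0,1} is at most 1/4. *)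
    have := sqr_ge0 (1 - p - p * expR x); rewrite /D; nra.
  by rewrite /S /D expR0 mul0r add0r mulr1 subrK invr1 mulr1.
pose F (s : R) := s ^+ 2 / 8 + s * p - ln (D s).
have dF (s : R) : is_derive s 1 F (S s - (1 - p)).
  rewrite /F; have Ds := lt0r_neq0 (D0 s).
  have dL := @is_derive1_comp R (@ln R) D s _ _ (is_derive1_ln (D0 s)) (dD s).
  apply: is_derive_eq; rewrite /GRing.scale /= /S.
  have -> : p * expR s = D s - (1 - p) by rewrite /D; ring.
  by field; rewrite Ds.
have : F 0 <= F t.
  by apply: (le_of_derive_ge0 dF _ t0) => x x0; rewrite subr_ge0 S0.
rewrite {1}/F /D expR0 mulr1 subrK ln1 expr0n /= !mul0r addr0 subr0 => Ft.
have -> : p * expR (t * (1 - p)) + (1 - p) * expR (- (t * p)) =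
    expR (- (t * p)) * D t.
  have -> : t * (1 - p) = - (t * p) + t by ring.
  by rewrite expRD /D; ring.
have -> : D t = expR (ln (D t)) by rewrite lnK // posrE.
rewrite -expRD ler_expR -subr_ge0; apply: le_trans Ft _.
by rewrite /F opprD opprK addrA.
Qed.

(** A negative t reduces to a positive one by exchanging success and failure. *)
Lemma hoeffding_bernoulli (p t : R) : 0 <= p <= 1 ->
  p * expR (t * (1 - p)) + (1 - p) * expR (- (t * p)) <= expR (t ^+ 2 / 8).
Proof.
move=> /andP [p0 p1]; have [t0|t0] := leP 0 t; first by apply: hoeffding_bernoulli_ge0; rewrite ?p0.
have p01 : 0 <= 1 - p <= 1 by lra.
have t0' : 0 <= - t by lra.
by have := hoeffding_bernoulli_ge0 p01 t0'; rewrite sqrrN subKr !mulNr opprK addrC.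
Qed.

End Hoeffding.

(** * Parents and reward under an intervention *)

Section Instance.
Variables (R : realType) (B : causal_bandit R).
Implicit Types (a : intervention B) (y : pavec B) (x : assignment B).

Definition do_kernel a (v : node B) x (w : rng v) : R :=
  if a v is Some w' then (w == w')%:R else cpt x w.

Lemma do_kernel_sum1 a v x : \sum_(w : rng v) do_kernel a x w = 1.
Proof.
rewrite /do_kernel; case: (a v) => [w'|]; last exact: cpt_sum1.
by rewrite (bigD1 w') //= eqxx big1 ?addr0 // => w /negPf ->.
Qed.

Lemma do_kernel_local a v x x' :
  (forall u, edge u v -> x u = x' u) ->
  forall w : rng v, do_kernel a x w = do_kernel a x' w.
Proof. by move=> xx' w; rewrite /do_kernel; case: (a v) => // ; apply: cpt_local. Qed.

Lemma do_prob_ge0 a x : 0 <= do_prob a x.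
Proof.
apply: prodr_ge0 => v _; case: (a v) => [w|]; first by rewrite ler0n.
exact: cpt_ge0.
Qed.

Lemma sum_do_prob a : \sum_x do_prob a x = 1.
Proof. exact: sum_prod_kernel (@do_kernel_sum1 a) (@do_kernel_local a). Qed.

Lemma card_pavec : #|pavec B| = (#|` pvals B| ^ npar B)%N.
Proof. by rewrite card_ffun card_ord cardfE. Qed.

Lemma pa_eq_unique x : exists y0, forall y, pa_eq x y = (y == y0).
Proof.
have sub (i : 'I_(npar B)) : val (x (tnth (par B) i)) \in pvals B.
  by apply: (fsubsetP (par_rng (mem_tnth i (par B)))); exact: valP.
exists [ffun i => [` sub i]%fset] => y; apply/forallP/eqP => [xy|-> i].
  by apply/ffunP => i; rewrite ffunE; apply/val_inj/esym/eqP; exact: xy.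
by rewrite ffunE.
Qed.

Lemma pa_prob_ge0 a y : 0 <= pa_prob a y.
Proof. by apply: sumr_ge0 => x _; exact: do_prob_ge0. Qed.

Lemma sum_pa_prob a : \sum_y pa_prob a y = 1.
Proof.
rewrite /pa_prob (exchange_big_dep xpredT) //= -(sum_do_prob a).
apply: eq_bigr => x _; have [y0 xy] := pa_eq_unique x.
by rewrite (bigD1 y0) ?xy //= big1 ?addr0 // => y; rewrite xy andbN.
Qed.

Lemma reward_val (w : rng (reward B)) : val w = (val w == 1)%:R.
Proof.
have : val w \in [fset 0; 1 : R]%fset by rewrite -(reward_rng B) (valP w).
rewrite !inE => /orP [] /eqP ->; rewrite ?eqxx //.
by rewrite eq_sym oner_eq0.
Qed.

Lemma mean_reward_bernoulli x (b : bool) :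
  \sum_(w : rng (reward B) | val w == b%:R) cpt x w =
  if b then \sum_(w : rng (reward B)) val w * cpt x w
  else 1 - \sum_(w : rng (reward B)) val w * cpt x w.
Proof.
have E1 : \sum_(w : rng (reward B)) val w * cpt x w =
    \sum_(w : rng (reward B) | val w == 1) cpt x w.
  rewrite [RHS]big_mkcond /=; apply: eq_bigr => w _.
  by rewrite {1}reward_val; case: eqP; rewrite ?mul1r ?mul0r.
rewrite E1; case: b => //.
have := @cpt_sum1 _ B (reward B) x.
rewrite (bigID (fun w : rng (reward B) => val w == 1)) /= => S1.
transitivity (\sum_(w : rng (reward B) | val w != 1) cpt x w).
  apply: eq_bigl => w; have /= := reward_val w.
  by case: eqP => [-> _|_ ->]; rewrite ?oner_eq0 ?eqxx.
by move: S1; lra.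
Qed.

(** The assignment picked in [mu_pa] is immaterial: any two that match y agree on the parents of the
    reward, and the kernel is local. *)
Lemma mu_paE x y : pa_eq x y ->
  mu_pa y = \sum_(w : rng (reward B)) val w * cpt x w.
Proof.
move=> xy; rewrite /mu_pa; case: pickP => [x' x'y|/(_ x)]; last by rewrite xy.
apply: eq_bigr => w _; congr (_ * _); apply: cpt_local => u.
rewrite -par_edge => /tnthP [i ->]; apply: val_inj.
by rewrite (eqP (forallP x'y i)) (eqP (forallP xy i)).
Qed.

Lemma mu_pa_ge0 y : 0 <= mu_pa y.
Proof.
rewrite /mu_pa; case: pickP => // x _; apply: sumr_ge0 => w _.
by rewrite reward_val mulr_ge0 // cpt_ge0.
Qed.

Lemma mu_pa_le1 y : mu_pa y <= 1.
Proof.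
rewrite /mu_pa; case: pickP => // x _; rewrite -(@cpt_sum1 _ B (reward B) x).
apply: ler_sum => w _; rewrite reward_val ler_piMl ?cpt_ge0 //.
by case: eqP.
Qed.

(** Apply [sum_node_kernel] at the reward node to the indicator of Pa(Y) = y: parents are not
    descendants of the reward, and an arm leaves the kernel of the reward intact. *)
Lemma obs_probE a y b : a \in arms B ->
  obs_prob a y b = (if b then mu_pa y else 1 - mu_pa y) * pa_prob a y.
Proof.
move=> aA; pose g x : R := (pa_eq x y)%:R.
have gsum (Q : pred (assignment B)) : \sum_(x | Q x) g x * do_prob a x =
    \sum_(x | pa_eq x y && Q x) do_prob a x.
  rewrite big_mkcond [RHS]big_mkcond; apply: eq_bigr => x _; rewrite /g andbC.
  by case: (Q x); case: (pa_eq x y); rewrite ?mul1r ?mul0r.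
transitivity (\sum_(x : assignment B | val (x (reward B)) == b%:R)
                g x * do_prob a x); first by rewrite gsum.
rewrite /pa_prob -(eq_bigl _ _ (fun x => andbT (pa_eq x y))) -(gsum xpredT).
apply: (sum_node_kernel (@do_kernel_sum1 a) (@do_kernel_local a)
  (u := reward B) (P := fun w => val w == b%:R)) => [x v w|x].
- move=> rv; rewrite /g; congr (nat_of_bool _)%:R; apply: eq_forallb => i; rewrite upd_out //.
  have := mem_tnth i (par B); rewrite par_edge => e.
  apply/eqP => vi; move: rv; rewrite vi; case/orP => [/eqP r|c].
    by move: e; rewrite r edge_irrefl.
  by have := acyclic e; rewrite c.
- rewrite /g /do_kernel (arms_reward aA) pnatr_eq0 eqb0 negbK => xy.
  by rewrite mean_reward_bernoulli (mu_paE xy).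
Qed.

Lemma sum_obs_prob a y (f : bool -> R) : a \in arms B ->
  \sum_b obs_prob a y b * f b =
  pa_prob a y * (mu_pa y * f true + (1 - mu_pa y) * f false).
Proof. by move=> aA; rewrite big_bool /= !obs_probE //; ring. Qed.

Lemma obs_prob_ge0 a y b : 0 <= obs_prob a y b.
Proof. by apply: sumr_ge0 => x _; exact: do_prob_ge0. Qed.

Lemma mu_ge0 a : 0 <= mu a.
Proof. by apply: sumr_ge0 => y _; rewrite mulr_ge0 ?mu_pa_ge0 ?pa_prob_ge0. Qed.

Lemma mu_le1 a : mu a <= 1.
Proof.
rewrite -(sum_pa_prob a); apply: ler_sum => y _.
by rewrite ler_piMl ?mu_pa_le1 ?pa_prob_ge0.
Qed.

Lemma mu_max_attained : exists2 b, b \in arms B & mu b = mu_max B.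
Proof.
have [a0 a0A] := set0Pn _ (arms_neq0 B).
have [|b bA bE] := @eq_bigmax _ _ _ 0 a0 (mem (arms B)) (@mu R B) a0A.
  by move=> a _; exact: mu_ge0.
by exists b.
Qed.

Lemma Delta_ge0 a : a \in arms B -> 0 <= Delta a.
Proof. by move=> aA; rewrite subr_ge0 /mu_max; apply: le_bigmax_cond. Qed.

Lemma Delta_le1 a : Delta a <= 1.
Proof.
have [b _ bE] := mu_max_attained.
by rewrite /Delta -bE; have := mu_le1 b; have := mu_ge0 a; lra.
Qed.

Lemma cmin_le a y : a \in arms B -> cmin y <= pa_prob a y.
Proof. by move=> aA; apply: bigmin_le_cond. Qed.

Lemma cmin_le1 y : cmin y <= 1.
Proof. exact: bigmin_le_id. Qed.

Lemma cmin_gt0 a y : same_support B -> a \in arms B ->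
  (0 < cmin y) = (0 < pa_prob a y).
Proof.
move=> supp aA; apply/idP/idP => [c0|a0].
  exact: lt_le_trans c0 (cmin_le _ aA).
by apply: lt_bigmin => // b bA; rewrite (supp b a).
Qed.

Lemma sum_cmin a (f : pavec B -> R) : same_support B -> a \in arms B ->
  \sum_y f y * pa_prob a y = \sum_(y | 0 < cmin y) f y * pa_prob a y.
Proof.
move=> supp aA; rewrite (bigID (fun y => 0 < cmin y)) /= [X in _ + X]big1 ?addr0 //.
move=> y; rewrite (cmin_gt0 _ supp aA) lt_neqAle pa_prob_ge0 andbT negbK => /eqP <-.
by rewrite mulr0.
Qed.

Lemma exists_cmin_gt0 : same_support B -> exists y : pavec B, 0 < cmin y.
Proof.
move=> supp; have [b bA _] := mu_max_attained; apply/existsP.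
apply: contraT; rewrite negb_exists => /forallP c0.
have := sum_cmin (fun=> 1) supp bA; rewrite [RHS]big_pred0; last first.
  by move=> y; apply/negbTE/c0.
under eq_bigr do rewrite mul1r.
by rewrite sum_pa_prob => /eqP; rewrite oner_eq0.
Qed.

Lemma zeta_ge1 a : same_support B -> a \in arms B -> 1 <= zeta a.
Proof.
move=> supp aA; have [y cy] := exists_cmin_gt0 supp.
rewrite /zeta (bigD1 y) //= -[leLHS]addr0 lerD //.
  by rewrite ler_pdivlMr // mul1r cmin_le.
by apply: sumr_ge0 => z /andP [cz _]; rewrite divr_ge0 ?pa_prob_ge0 // ltW.
Qed.

End Instance.

(** * Expectations over histories *)

Section Histories.
Variables (R : realType) (B : causal_bandit R) (pol : policy B).
Hypothesis polP : is_policy pol.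
Implicit Types (h : seq (round B)) (r : round B) (F G : seq (round B) -> R).

(** Conditional expectation of F after one more round, given the history h; iterating it n times
    looks n rounds ahead. *)
Definition step F h : R :=
  \sum_r pol h (r_arm r) * obs_prob (r_arm r) (r_pa r) (r_rew r) * F (rcons h r).

(** The prefix h0 is general so that the induction can peel off the first round. *)
Lemma history_sum T F h0 :
  \sum_(h : T.-tuple (round B))
     (\prod_(t < T) (let r := tnth h t in pol (h0 ++ take t h) (r_arm r) *
        obs_prob (r_arm r) (r_pa r) (r_rew r))) * F (h0 ++ h) =
  iter T step F h0.
Proof.
elim: T h0 => [|T IH] h0.
  rewrite (big_pred1 [tuple]) => [|h]; last by rewrite [h]tuple0 inE; apply/esym/eqP.
  by rewrite big_ord0 mul1r cats0.
rewrite iterS /step.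
under [RHS]eq_bigr do rewrite -IH mulr_sumr.
rewrite pair_big /=.
rewrite (reindex (fun p : round B * T.-tuple (round B) => [tuple of p.1 :: p.2])).
  apply: eq_bigr => -[r h] _; rewrite big_ord_recl /= tnth0 ?take0 cats0 cat_rcons.
  rewrite -!mulrA; do 3 congr (_ * _); apply: eq_bigr => i _.
  by rewrite tnthS /= cat_rcons.
exists (fun h : T.+1.-tuple (round B) => (thead h, [tuple of behead h])) => [[r h] _|h _] /=.
  by rewrite theadE; congr (_, _); apply: val_inj.
by rewrite -tuple_eta.
Qed.

(** Histories whose every arm had positive probability under the policy. Estimates are needed only
    on these, as all others have weight 0 in [step]. *)
Inductive played : seq (round B) -> Prop :=
| played_nil : played [::]
| played_rcons h r : played h -> 0 < pol h (r_arm r) -> played (rcons h r).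

Lemma pol_ge0 h a : 0 <= pol h a.
Proof. by have [] := polP h. Qed.

Lemma pol_arm h a : 0 < pol h a -> a \in arms B.
Proof.
have [_ p0 _] := polP h => ha; apply: contraTT ha => /p0 ->.
by rewrite ltxx.
Qed.

Lemma pol_le1 h a : pol h a <= 1.
Proof.
have [p0 pN p1] := polP h; have [aA|/pN -> //] := boolP (a \in arms B).
by rewrite -p1 (bigD1 a) //= lerDl sumr_ge0.
Qed.

Lemma played_arms h r : played h -> r \in h -> r_arm r \in arms B.
Proof.
elim=> // h' r' _ IH pr; rewrite mem_rcons inE => /orP [/eqP -> |//].
exact: pol_arm pr.
Qed.

Lemma step_le F G h : played h ->
  (forall r, played (rcons h r) -> F (rcons h r) <= G (rcons h r)) ->
  step F h <= step G h.
Proof.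
move=> ph FG; apply: ler_sum => r _.
have [pr|] := ltP 0 (pol h (r_arm r)); last first.
  move=> pr; have -> : pol h (r_arm r) = 0 by apply: le_anti; rewrite pr pol_ge0.
  by rewrite !mul0r.
apply: ler_wpM2l; first by rewrite mulr_ge0 ?pol_ge0 ?obs_prob_ge0.
by apply: FG; constructor.
Qed.

Lemma iter_step_le n F G h : played h ->
  (forall h', played h' -> size h' = (size h + n)%N -> F h' <= G h') ->
  iter n step F h <= iter n step G h.
Proof.
elim: n h => [|n IH] h ph FG /=; first by apply: FG; rewrite ?addn0.
apply: step_le => // r pr; apply: IH => // h' ph' sh'; apply: FG => //.
by rewrite sh' size_rcons addSnnS.
Qed.

Lemma eq_step F G h : F =1 G -> step F h = step G h.
Proof. by move=> FG; apply: eq_bigr => r _; rewrite FG. Qed.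

Lemma iter_stepZ n c F h :
  iter n step (fun h' => c * F h') h = c * iter n step F h.
Proof.
elim: n h => //= n IH h; rewrite (eq_step _ IH) /step mulr_sumr.
by apply: eq_bigr => r _; rewrite mulrCA.
Qed.

Lemma iter_step_sum n (I : finType) (P : pred I) (F : I -> seq (round B) -> R) h :
  iter n step (fun h' => \sum_(i | P i) F i h') h =
  \sum_(i | P i) iter n step (F i) h.
Proof.
elim: n h => //= n IH h; rewrite (eq_step _ IH) /step exchange_big /=.
by apply: eq_bigr => r _; rewrite mulr_sumr.
Qed.

Lemma iter_stepD n F G h :
  iter n step (fun h' => F h' + G h') h = iter n step F h + iter n step G h.
Proof.
elim: n h => //= n IH h; rewrite (eq_step _ IH) /step -big_split /=.
by apply: eq_bigr => r _; rewrite mulrDr.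
Qed.

Lemma stepE F h : step F h =
  \sum_(a in arms B) pol h a * \sum_y \sum_b obs_prob a y b * F (rcons h (a, y, b)).
Proof.
have -> : step F h = \sum_a \sum_y \sum_b
    pol h a * obs_prob a y b * F (rcons h (a, y, b)).
  rewrite pair_big /= pair_big /=; apply: eq_bigr => -[[a y] b] _ //.
rewrite [RHS]big_mkcond /=; apply: eq_bigr => a _; case: ifPn => aA.
  rewrite mulr_sumr; apply: eq_bigr => y _; rewrite mulr_sumr.
  by apply: eq_bigr => b _; rewrite mulrA.
have [_ pN _] := polP h; rewrite pN //.
by rewrite big1 // => y _; rewrite big1 // => b _; rewrite !mul0r.
Qed.

Lemma step_arm (f : intervention B -> R) F h :
  (forall r, F (rcons h r) = f (r_arm r)) ->
  step F h = \sum_(a in arms B) pol h a * f a.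
Proof.
move=> Ff; rewrite stepE; apply: eq_bigr => a aA; congr (_ * _).
rewrite -[RHS]mul1r -(sum_pa_prob a) mulr_suml; apply: eq_bigr => y _.
have := sum_obs_prob y (fun=> f a) aA.
rewrite -mulrDl addrC subrK mul1r => <-.
by apply: eq_bigr => b _; rewrite Ff.
Qed.

Lemma step_count a h : a \in arms B ->
  step (fun h' => (count (fun r => r_arm r == a) h')%:R) h =
  (count (fun r => r_arm r == a) h)%:R + pol h a.
Proof.
move=> aA; rewrite (@step_arm (fun b => (count (fun r => r_arm r == a) h + (b == a))%:R)).
  under eq_bigr do rewrite natrD mulrDr.
  have [_ _ p1] := polP h.
  rewrite big_split /= -mulr_suml p1 mul1r (bigD1 a) //= eqxx mulr1 big1 ?addr0 //.
  by move=> b /andP [_ /negPf ->]; rewrite mulr0.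
by move=> r; rewrite -cats1 count_cat /= addn0.
Qed.

Lemma iter_step_const n c h : iter n step (fun=> c) h = c.
Proof.
elim: n h => //= n IH h; rewrite (eq_step _ IH) (@step_arm (fun=> c)) //.
by have [_ _ p1] := polP h; rewrite -mulr_suml p1 mul1r.
Qed.

Definition weight (y : pavec B) (w : bool -> R) h : R :=
  \prod_(r <- h | r_pa r == y) w (r_rew r).

(** Under arm a the new factor averages rho with probability [pa_prob a y] and is 1 otherwise. As
    rho <= 1, the mean 1 - P (1 - rho) is largest at P = c_y, whichever arm is chosen. *)
Lemma step_weight y w h : same_support B -> (forall b, 0 <= w b) ->
  mu_pa y * w true + (1 - mu_pa y) * w false <= 1 ->
  step (weight y w) h <=
  (1 - cmin y * (1 - (mu_pa y * w true + (1 - mu_pa y) * w false))) * weight y w h.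
Proof.
set rho := _ + _ => supp w0 rho1; rewrite stepE.
have W0 : 0 <= weight y w h by apply: prodr_ge0 => r _.
have step1 a : a \in arms B ->
    \sum_y' \sum_b obs_prob a y' b * weight y w (rcons h (a, y', b)) <=
    (1 - cmin y * (1 - rho)) * weight y w h.
  move=> aA; rewrite (bigD1 y) //=.
  rewrite (eq_bigr (fun b => obs_prob a y b * (weight y w h * w b))); last first.
    by move=> b _; rewrite /weight big_rcons /= eqxx.
  rewrite sum_obs_prob //.
  rewrite (eq_bigr (fun y' => pa_prob a y' * weight y w h)); last first.
    move=> y' y'y.
    have := sum_obs_prob y' (fun=> weight y w h) aA.
    rewrite -mulrDl addrC subrK mul1r => <-; apply: eq_bigr => b _.
    by rewrite /weight big_rcons /r_pa /= (negPf y'y) mulr1.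
  rewrite -mulr_suml; have := sum_pa_prob a; rewrite (bigD1 y) //=.
  set S := \sum_(_ | _) _ => S1.
  have -> : S = 1 - pa_prob a y by move: S1; lra.
  have -> : pa_prob a y * (mu_pa y * (weight y w h * w true) +
      (1 - mu_pa y) * (weight y w h * w false)) + (1 - pa_prob a y) * weight y w h
      = (1 - pa_prob a y * (1 - rho)) * weight y w h by rewrite /rho; ring.
  rewrite ler_wpM2r // lerD2l lerN2 ler_wpM2r ?subr_ge0 //; exact: cmin_le.
have [_ _ p1] := polP h; set K := (X in _ <= X).
have -> : K = \sum_(a in arms B) pol h a * K by rewrite -mulr_suml p1 mul1r.
by apply: ler_sum => a aA; rewrite ler_wpM2l ?pol_ge0 //; exact: step1.
Qed.

Lemma iter_step_weight n y w : same_support B -> (forall b, 0 <= w b) ->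
  mu_pa y * w true + (1 - mu_pa y) * w false <= 1 ->
  iter n step (weight y w) [::] <=
  (1 - cmin y * (1 - (mu_pa y * w true + (1 - mu_pa y) * w false))) ^+ n.
Proof.
move=> supp w0 rho1; set k := 1 - _.
have k0 : 0 <= k.
  rewrite /k; have := cmin_le1 y; have rho0 : 0 <= mu_pa y * w true + (1 - mu_pa y) * w false.
    by rewrite addr_ge0 // mulr_ge0 ?subr_ge0 ?mu_pa_le1 ?mu_pa_ge0.
  have := mulr_ge0 (_ : 0 <= 1 - cmin y) (_ : 0 <= 1 - (mu_pa y * w true + (1 - mu_pa y) * w false)).
  rewrite !subr_ge0 => /(_ (cmin_le1 y) rho1); move: rho0; set rho := _ + _; lra.
elim: n => [|n IH]; first by rewrite /= /weight big_nil.
rewrite iterSr exprS.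
apply: (@le_trans _ _ (iter n step (fun h => k * weight y w h) [::])).
  apply: iter_step_le; first by constructor.
  by move=> h _ _; apply: step_weight.
by rewrite iter_stepZ ler_wpM2l.
Qed.

End Histories.

(** * The logarithmic threshold *)

Section LogThreshold.
Variable R : realType.
Implicit Types (C : R) (K t : nat).

Definition log_half K t : R := ln (K%:R * t%:R ^+ 2 / 2).

Lemma ln2_gt_half : 1 / 2 < ln 2 :> R.
Proof.
rewrite -ltr_expR lnK ?posrE //.
have H : 1 - 1 / 2 < (expR (1 / 2))^-1 :> R.
  by rewrite -expRN; apply: expR_gt1Dx; rewrite oppr_eq0 mul1r invr_eq0 pnatr_eq0.
have := mulr_gt0 (expR_gt0 (1 / 2 : R)) (_ : 0 < (expR (1 / 2))^-1 - (1 - 1 / 2)).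
rewrite subr_gt0 => /(_ H); rewrite mulrBr divff ?expR_eq0 //; lra.
Qed.

Lemma log_half_ge K t m : (2 ^ m.+1 <= K * t ^ 2)%N -> m%:R * ln 2 <= log_half K t.
Proof.
move=> Km; rewrite mulr_natl -lnXn // ler_ln ?posrE ?exprn_gt0 //.
  rewrite ler_pdivlMr // -exprSr -!natrX -natrM ler_nat; exact: Km.
by rewrite divr_gt0 // -natrX -natrM ltr0n (leq_trans _ Km) // expn_gt0.
Qed.

(** If K t^2 >= 32 the logarithm is at least 4 ln 2 > 2. Otherwise t <= 5, and each such t
    contradicts C log(K t^2/2) <= t. *)
Lemma log_half_ge2 C K t : 4 <= C -> (2 < K * t ^ 2)%N ->
  C * log_half K t <= t%:R -> 2 <= log_half K t.
Proof.
move=> C4 Kt Ct; have l2 := ln2_gt_half.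
have [big|small] := leqP 32 (K * t ^ 2).
  by have := @log_half_ge K t 4 big; lra.
have t6 : (t <= 5)%N.
  rewrite leqNgt; apply/negP => t5; have : (6 * 6 <= t * t)%N by exact: leq_mul.
  by move: small Kt; rewrite mulnn; case: (K) => // k; nia.
have lower m : (2 ^ m.+1 <= K * t ^ 2)%N -> 4 * (m%:R * ln 2) <= t%:R :> R.
  move=> /log_half_ge lm; apply: le_trans Ct.
  have m0 : 0 <= m%:R * ln 2 :> R by rewrite mulr_ge0 // ltW //; lra.
  by rewrite ler_pM //; lra.
exfalso; move: t t6 Kt lower Ct {small} => [|[|[|[|[|[|//]]]]]] _ Kt lower Ct; first by nia.
(* For t = 1, K >= 3 and ln(K/2) >= 1 - 2/K >= 1/3, which exceeds 1/4. *)
- have : 1 - 1 / (3 / 2) <= log_half K 1.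
    have K3 : 3%:R <= K%:R :> R by rewrite ler_nat; nia.
    rewrite /log_half expr1n mulr1.
    have -> : K%:R / 2 = (2 / K%:R : R)^-1 by rewrite invf_div.
    have K0 : 0 < 2 / K%:R :> R by rewrite divr_gt0 //; lra.
    rewrite lnV ?posrE // lerNr; have := @le_ln1Dx R (2 / K%:R - 1).
    rewrite [1 + _]addrC subrK => H; have : ln (2 / K%:R) <= 2 / K%:R - 1 :> R by apply: H; lra.
    have : 2 / K%:R <= 2 / 3 :> R by rewrite ler_pM2l // lef_pV2 ?posrE //; lra.
    lra.
  by move: Ct => /=; nra.
- by have := lower 1%N _; rewrite /= => H; have := H ltac:(nia); lra.
- by have := lower 2%N _; rewrite /= => H; have := H ltac:(nia); lra.
- by have := lower 3%N _; rewrite /= => H; have := H ltac:(nia); lra.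
- by have := lower 3%N _; rewrite /= => H; have := H ltac:(nia); lra.
Qed.

(** From s to s + 1 the logarithm grows by 2 ln(1 + 1/s) <= 2/s. Since it is at least 2, 2 C <= s,
    so the left side grows by at most 1, as does the right side. *)
Lemma log_half_monotone C K t s : 4 <= C -> (2 < K * t ^ 2)%N ->
  C * log_half K t <= t%:R -> (t <= s)%N ->
  C * log_half K s <= s%:R /\ 2 <= log_half K s.
Proof.
move=> C4 Kt Ct; have l2 := log_half_ge2 C4 Kt Ct.
elim: s => [|s IH]; first by rewrite leqn0 => /eqP t0; move: Kt; rewrite t0 muln0.
rewrite leq_eqVlt => /orP [/eqP <- //|ts].
have [Cs ls] := IH ts.
have K0 : (0 < K)%N by case: (K) Kt.
have s0 : (0 < s)%N by case: (t) ts Kt => [|?]; rewrite ?muln0 //; lia.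
have sR : 0 < s%:R :> R by rewrite ltr0n.
have KR : 0 < K%:R :> R by rewrite ltr0n.
have E : log_half K s.+1 = log_half K s + ln (1 + s%:R^-1) *+ 2.
  rewrite -lnXn ?addr_gt0 ?invr_gt0 // -lnM ?posrE; last 2 first.
  - by rewrite divr_gt0 // mulr_gt0 // exprn_gt0.
  - by rewrite exprn_gt0 // addr_gt0 // invr_gt0.
  congr (ln _); rewrite -addn1 natrD; field; exact: lt0r_neq0.
have ln0 : 0 <= ln (1 + s%:R^-1) :> R by rewrite ln_ge0 // lerDl invr_ge0 ltW.
have ln1 : ln (1 + s%:R^-1) <= s%:R^-1 :> R.
  by rewrite le_ln1Dx // (lt_trans (ltrN10 _)) // invr_gt0.
rewrite E; split; last by rewrite -[leLHS]addr0 lerD // mulrn_wge0.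
rewrite mulrDr -[s.+1]addn1 natrD lerD //.
have -> : C * (ln (1 + s%:R^-1) *+ 2) = ln (1 + s%:R^-1) * (C * 2) by ring.
have : C * 2 <= s%:R by apply: le_trans Cs; rewrite ler_wpM2l //; lra.
move=> Cs2; apply: (@le_trans _ _ (s%:R^-1 * s%:R)); last by rewrite mulVf // lt0r_neq0.
by rewrite ler_pM //; lra.
Qed.

Lemma exists_log_half_le C K : 4 <= C -> (0 < K)%N ->
  exists t, [&& (0 < t)%N, (2 < K * t ^ 2)%N & C * log_half K t <= t%:R].
Proof.
move=> C4 K0; pose m := Num.bound (C * (K%:R + 4)).
(* The witness is t = m^2 with m > C (K + 4): then log(K t^2/2) = ln(K/2) + 4 ln m <= (K + 4) m. *)
have KR : 1 <= K%:R :> R by rewrite ler1n.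
have CK0 : 0 <= C * (K%:R + 4) by apply: mulr_ge0; lra.
have mC : C * (K%:R + 4) < m%:R := archi_boundP CK0.
have m2 : 2 < m%:R :> R by nra.
have m2n : (2 < m)%N by rewrite -(ltr_nat R).
exists (m ^ 2)%N; apply/and3P; split.
- by rewrite expn_gt0; lia.
- have m2' : (2 < m ^ 2)%N by nia.
  by apply: leq_trans (leq_pmull _ K0); nia.
have m0 : 0 < m%:R :> R by lra.
have -> : log_half K (m ^ 2) = ln (K%:R / 2) + ln m%:R *+ 4.
  rewrite -lnXn // -lnM; last 2 first.
  - by rewrite posrE divr_gt0 //; lra.
  - by rewrite posrE exprn_gt0.
  by congr (ln _); rewrite natrX; field.
have l1 := @ln_sublinear R _ m0.
have l2 := @ln_sublinear R (K%:R / 2) ltac:(lra).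
have -> : ln m%:R *+ 4 = 4 * ln m%:R :> R by ring.
rewrite natrX expr2.
apply: (@le_trans _ _ (C * (K%:R + 4) * m%:R)); last by rewrite ler_pM2r // ltW.
by rewrite -mulrA ler_pM2l; nra.
Qed.

End LogThreshold.

(** * Concentration of the estimates *)

Section Concentration.
Variables (R : realType) (B : causal_bandit R).
Implicit Types (h : seq (round B)) (y : pavec B) (x t : R).

Definition deviates y x h : bool := x <= `|mu_pa_hat h y - mu_pa y|.

Definition exp_weight y t z (b : bool) : R := expR (t * (b%:R - mu_pa y) - z).

Lemma weight_exp y t z h :
  weight y (exp_weight y t z) h =
  expR ((nobs h y)%:R * (t * (mu_pa_hat h y - mu_pa y) - z)).
Proof.
rewrite /weight /exp_weight -expR_sum; congr expR.
pose n := nobs h y; pose S : R := \sum_(r <- h) (r_rew r)%:R * (r_pa r == y)%:R.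
have -> : \sum_(r <- h | r_pa r == y) (t * ((r_rew r)%:R - mu_pa y) - z) =
    t * (S - n%:R * mu_pa y) - n%:R * z.
  rewrite /S /n /nobs; elim: (h) => [|r s IH]; first by rewrite !big_nil /=; ring.
  rewrite !big_cons /= natrD IH; case: (r_pa r == y) => /=; ring.
rewrite /mu_pa_hat -/S -/n; case: ltnP => n0.
  by field; rewrite pnatr_eq0 -lt0n.
(* Without observations the default estimate 0 is harmless, because the factor N = 0 kills the
   exponent. *)
have n00 : n = 0%N by apply/eqP; rewrite -leqn0.
suff -> : S = 0 by rewrite n00; ring.
apply: big1_seq => r /= rh; case: eqP => ry; last by rewrite mulr0.
by have := n00; rewrite /n /nobs => /eqP; rewrite -leqn0 leqNgt -has_count;
  case: hasP => // -[]; exists r => //; apply/eqP.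
Qed.

(** Hoeffding gives exp(t^2/8 - 4 x^2), and |t| = 4 x minimizes t^2/8 - |t| x. Only t^2 is fixed, so
    that both tails are covered. *)
Lemma exp_weight_mean y t x : 0 <= x -> t ^+ 2 = (4 * x) ^+ 2 ->
  mu_pa y * exp_weight y t (4 * x ^+ 2) true +
  (1 - mu_pa y) * exp_weight y t (4 * x ^+ 2) false <= expR (- (2 * x ^+ 2)).
Proof.
move=> x0 tx; have m01 : 0 <= mu_pa y <= 1 by rewrite mu_pa_ge0 mu_pa_le1.
have := hoeffding_bernoulli t m01; rewrite /exp_weight /= => H.
rewrite sub0r mulrN !expRD.
rewrite [X in X <= _](_ : _ = (mu_pa y * expR (t * (1 - mu_pa y)) +
    (1 - mu_pa y) * expR (- (t * mu_pa y))) * expR (- (4 * x ^+ 2))); last by ring.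
apply: (@le_trans _ _ (expR (t ^+ 2 / 8) * expR (- (4 * x ^+ 2)))).
  by rewrite ler_wpM2r ?expR_ge0.
by rewrite -expRD tx ler_expR; lra.
Qed.

Lemma expRN_le x : 0 <= x -> expR (- x) <= (1 + x)^-1.
Proof.
move=> x0; rewrite expRN lef_pV2 ?posrE ?expR_gt0 ?expR_ge1Dx //; lra.
Qed.

Variables (pol : policy B).
Hypothesis polP : is_policy pol.

(* If y was never observed, mu_pa_hat is 0 but both weights are 1. *)
Lemma deviates_weight y x h : 0 <= x ->
  (deviates y x h)%:R <= weight y (exp_weight y (4 * x) (4 * x ^+ 2)) h +
                         weight y (exp_weight y (- (4 * x)) (4 * x ^+ 2)) h.
Proof.
move=> x0; rewrite !weight_exp /deviates; set d := _ - _.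
have [|_] := leP x `|d|; last by rewrite addr_ge0 ?expR_ge0.
have N0 : 0 <= (nobs h y)%:R :> R by [].
rewrite ler_normr => /orP [xd|xd]; [rewrite -[leLHS]addr0|rewrite -[leLHS]add0r];
  rewrite lerD ?expR_ge0 // -[leLHS]expR0 ler_expR mulr_ge0 //; nra.
Qed.

Lemma mu_pa_hat_ge0 h y : 0 <= mu_pa_hat h y.
Proof.
rewrite /mu_pa_hat; case: ifP => // _; rewrite divr_ge0 //.
by apply: sumr_ge0 => r _; rewrite mulr_ge0.
Qed.

Lemma mu_pa_hat_le1 h y : mu_pa_hat h y <= 1.
Proof.
rewrite /mu_pa_hat; case: ltnP => // n0; rewrite ler_pdivrMr ?ltr0n // mul1r.
rewrite /nobs; elim: (h) => [|r s IH] /=; first by rewrite big_nil.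
rewrite big_cons natrD lerD //; case: (r_rew r); case: (r_pa r == y);
  by rewrite ?mul1r ?mul0r.
Qed.

Lemma deviates_tail y x n : same_support B -> 0 < cmin y -> 0 <= x ->
  2 * (cmin y * x) <= 1 ->
  iter n (step pol) (fun h => (deviates y x h)%:R) [::] <=
  2 * expR (- (n%:R * (cmin y * x) ^+ 2)).
Proof.
move=> supp c0 x0 cx; have c1 := cmin_le1 y; set c := cmin y in c0 c1 cx *.
(* Both means lie in [0, 1], so no deviation exceeds 1. *)
have [x1|x1] := ltP 1 x.
  apply: (@le_trans _ _ (iter n (step pol) (fun=> 0) [::])); last first.
    by rewrite iter_step_const // mulr_ge0 ?expR_ge0.
  apply: iter_step_le => //; first by constructor.
  move=> h _ _; suff /negbTE -> : ~~ deviates y x h by [].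
  rewrite /deviates -ltNge; apply: le_lt_trans x1; rewrite ler_norml.
  have := mu_pa_hat_ge0 h y; have := mu_pa_hat_le1 h y.
  by have := mu_pa_ge0 y; have := mu_pa_le1 y; lra.
have side t : t ^+ 2 = (4 * x) ^+ 2 ->
    iter n (step pol) (weight y (exp_weight y t (4 * x ^+ 2))) [::] <=
    expR (- (n%:R * (c * x) ^+ 2)).
  move=> tx; have := exp_weight_mean y x0 tx.
  have := @iter_step_weight R B pol polP n y (exp_weight y t (4 * x ^+ 2)) supp
    (fun b => expR_ge0 _).
  set rho := _ + _ => W rho_le.
  have x2 := sqr_ge0 x.
  have u1 := @expRN_le (2 * x ^+ 2) ltac:(lra).
  have inv0 : (1 + 2 * x ^+ 2)^-1 * (1 + 2 * x ^+ 2) = 1.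
    by rewrite mulVf // lt0r_neq0 //; lra.
  have rho1 : rho <= 1.
    by apply: le_trans rho_le _; rewrite expR_le1; lra.
  apply: le_trans (W rho1) _.
  (* From exp (- u) <= 1 / (1 + u) at u = 2 x^2, and c (1 + 2 x^2) <= 2. *)
  have key : (c * x) ^+ 2 <= c * (1 - rho).
    (* Write the left side as c + (2 c x) x and use c <= 1, 2 c x <= 1 and x <= 1. *)
    have : (1 + 2 * x ^+ 2) * c <= 2 by nra.
    move: u1 inv0; set v := _^-1 => u1 inv0 cx2.
    have vv : rho <= v by apply: le_trans rho_le u1.
    have v0 : 0 < v by rewrite invr_gt0; lra.
    rewrite exprMn expr2 -mulrA ler_pM2l //.
    have : 1 - v <= 1 - rho by lra.
    apply: le_trans.
    have -> : 1 - v = v * (2 * x ^+ 2) by move: inv0; lra.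
    have : c <= v * 2.
      have := ler_wpM2l (ltW v0) cx2; rewrite mulrA inv0 mul1r; exact.
    nra.
  have rho0 : 0 <= rho.
    by rewrite addr_ge0 // mulr_ge0 ?subr_ge0 ?mu_pa_le1 ?mu_pa_ge0 ?expR_ge0.
  rewrite -[X in _ <= expR X]mulrN expRM_natl.
  have base0 : 0 <= 1 - c * (1 - rho).
    have := ler_wpM2r (_ : 0 <= 1 - rho) c1; rewrite subr_ge0 mul1r => /(_ rho1).
    by move: rho0; lra.
  rewrite lerXn2r ?nnegrE ?expR_ge0 //.
  by apply: le_trans (expR_ge1Dx _); rewrite lerD2l lerN2.
apply: (@le_trans _ _ (iter n (step pol) (fun h =>
   weight y (exp_weight y (4 * x) (4 * x ^+ 2)) h +
   weight y (exp_weight y (- (4 * x)) (4 * x ^+ 2)) h) [::])).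
  apply: iter_step_le => //; first by constructor.
  by move=> h _ _; exact: deviates_weight.
rewrite iter_stepD //; have := side _ erefl; have := side _ (sqrrN (4 * x)); lra.
Qed.

End Concentration.

(** * Regret *)

Section Regret.
Variables (R : realType) (B : causal_bandit R).
Hypothesis supp : same_support B.
Implicit Types (a : intervention B) (h : seq (round B)) (y : pavec B).

Local Notation K := (#|` pvals B| ^ npar B)%N.

Definition radius (s : nat) : R := Num.sqrt (log_half R K s / s%:R).

Lemma K_gt0 : (0 < K)%N.
Proof.
have [y _] := exists_cmin_gt0 supp.
by rewrite -card_pavec; apply/card_gt0P; exists y.
Qed.

(** The condition reads C log(K s^2/2) <= s with C = 4 (zeta_a/Delta_a)^2, and C >= 4 because zeta_a
    >= 1 >= Delta_a. With the logarithm at least 2, this forces s >= 8. *)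
Lemma L2_spec a s : a \in arms B -> Delta a != 0 -> (L2 a <= s)%N ->
  [/\ (8 <= s)%N, 2 <= log_half R K s & L2_cond a s].
Proof.
move=> aA D0 Ls; have Dgt0 : 0 < Delta a by rewrite lt_neqAle eq_sym D0 Delta_ge0.
have D1 := Delta_le1 a; have z1 := zeta_ge1 supp aA.
pose C := 4 * (zeta a / Delta a) ^+ 2.
have condE t : L2_cond a t = (C * log_half R K t <= t%:R).
  by rewrite /L2_cond /C -/(log_half R K t); congr (_ <= _); field.
have C4 : 4 <= C.
  rewrite /C; have : 1 <= zeta a / Delta a by rewrite ler_pdivlMr // mul1r (le_trans D1).
  by move=> zD; rewrite ler_pMr // exprn_ege1.
(* The default value 0 of [first_pos] never occurs, since an admissible t exists. *)
move: Ls; rewrite /L2 /first_pos; case: pselect => [ex|nex]; last first.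
  have [t /and3P [t0 Kt Ct]] := exists_log_half_le C4 K_gt0.
  by case: nex; exists t; rewrite t0 Kt condE.
case: ex_minnP => t /and3P [t0 Kt]; rewrite !condE => Ct _ ts.
have [Cs ls] := log_half_monotone C4 Kt Ct ts.
split=> //; rewrite -(ler_nat R); apply: le_trans Cs.
have -> : 8%:R = 4 * 2 :> R by rewrite -natrM.
by rewrite ler_pM.
Qed.

Lemma radius_le a s : a \in arms B -> Delta a != 0 -> (L2 a <= s)%N ->
  2 * (radius s * zeta a) <= Delta a.
Proof.
move=> aA D0 Ls; have [s8 ls Cs] := L2_spec aA D0 Ls.
have Dgt0 : 0 < Delta a by rewrite lt_neqAle eq_sym D0 Delta_ge0.
have s0 : 0 < s%:R :> R by rewrite ltr0n; lia.
have z1 := zeta_ge1 supp aA.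
have z0 : 0 <= zeta a by lra.
have l0 : 0 <= log_half R K s / s%:R by rewrite divr_ge0 //; lra.
rewrite -(@ler_pXn2r _ 2) ?nnegrE ?mulr_ge0 ?sqrtr_ge0 ?(ltW Dgt0) //.
rewrite !exprMn /radius (sqr_sqrtr l0).
move: Cs; rewrite /L2_cond -/(log_half R K s) => Cs.
have := ler_wpM2r (divr_ge0 (exprn_ge0 2 (ltW Dgt0)) (ltW s0)) Cs.
have -> : s%:R * (Delta a ^+ 2 / s%:R) = Delta a ^+ 2 by field; rewrite lt0r_neq0.
by apply: le_trans; rewrite le_eqVlt; apply/orP; left; apply/eqP; field; rewrite ?D0 lt0r_neq0.
Qed.

Lemma ucbE h a : ucb h a = mu_hat h a + radius (size h) * zeta a.
Proof. by []. Qed.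

(** Weighting the errors, each below radius / c_y, by P(Pa(Y) = y | do(a)) sums to radius times
    zeta_a. Strictness needs some y with c_y > 0. *)
Lemma mu_hat_dev h a : a \in arms B ->
  (forall y, 0 < cmin y -> ~~ deviates y (radius (size h) / cmin y) h) ->
  `|mu_hat h a - mu a| < radius (size h) * zeta a.
Proof.
move=> aA nd.
have -> : mu_hat h a - mu a =
    \sum_(y | 0 < cmin y) (mu_pa_hat h y - mu_pa y) * pa_prob a y.
  by rewrite -sum_cmin // /mu_hat /mu -sumrB; apply: eq_bigr => y _; rewrite mulrBl.
apply: le_lt_trans (ler_norm_sum _ _ _) _.
rewrite /zeta mulr_sumr; apply: ltr_sum.
  have [y cy] := exists_cmin_gt0 supp; apply/hasP; exists y => //; exact: mem_index_enum.
move=> y cy; have ay : 0 < pa_prob a y by rewrite -cmin_gt0.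
have := nd y cy; rewrite /deviates -ltNge => dy.
by rewrite normrM (gtr0_norm ay) mulrCA mulrC ltr_pM2l // mulrC.
Qed.

Variables (pol : policy B).
Hypothesis polC : is_CUCB2 pol.

Let polP : is_policy pol := proj1 polC.

Definition num_deviating s h : R :=
  \sum_(y | 0 < cmin y) (deviates y (radius s / cmin y) h)%:R.

(** If no y deviates and b is optimal, then ucb_a < mu_a + 2 r zeta_a <= mu_a + Delta_a = mu_b <
    ucb_b, so a is not played. Otherwise the count is at least 1 and bounds any probability. *)
Lemma pol_le_bad a h : a \in arms B -> Delta a != 0 ->
  (L2 a <= size h)%N -> (#|arms B| <= size h)%N ->
  pol h a <= num_deviating (size h) h.
Proof.
move=> aA D0 Ls As.
have bad0 : 0 <= num_deviating (size h) h by apply: sumr_ge0.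
have [pa|] := ltP 0 (pol h a); last by move=> /le_trans; apply.
have := proj2 polC h a pa; rewrite ltnNge As /= => /forallP ucb_max.
apply: le_trans (pol_le1 polP h a) _; rewrite leNgt; apply/negP => bad1.
have nd y : 0 < cmin y -> ~~ deviates y (radius (size h) / cmin y) h.
  move=> cy; apply: contraTN bad1 => dy; rewrite -leNgt.
  by rewrite /num_deviating (bigD1 y) //= dy lerDl sumr_ge0.
have [b bA bmax] := mu_max_attained B.
have := ucb_max b; rewrite bA /= !ucbE => ub.
have := mu_hat_dev aA nd; have := mu_hat_dev bA nd.
have := radius_le aA D0 Ls; rewrite /Delta -bmax !ltr_norml.
by move: ub; lra.
Qed.

Lemma expect_bad a s : a \in arms B -> Delta a != 0 -> (L2 a <= s)%N ->
  iter s (step pol) (num_deviating s) [::] <= 4 / s%:R ^+ 2.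
Proof.
move=> aA D0 Ls; have [s8 ls _] := L2_spec aA D0 Ls.
have rz := radius_le aA D0 Ls; have z1 := zeta_ge1 supp aA; have D1 := Delta_le1 a.
have s0 : 0 < s%:R :> R by rewrite ltr0n; lia.
have K0 : 0 < K%:R :> R by rewrite ltr0n K_gt0.
have r0 : 0 <= radius s by exact: sqrtr_ge0.
have arg0 : 0 < K%:R * s%:R ^+ 2 / 2 :> R by rewrite divr_gt0 ?mulr_gt0 ?exprn_gt0.
rewrite /num_deviating iter_step_sum.
have tail y : 0 < cmin y ->
    iter s (step pol) (fun h => (deviates y (radius s / cmin y) h)%:R) [::] <=
    2 * (K%:R * s%:R ^+ 2 / 2)^-1.
  move=> cy; have cr : cmin y * (radius s / cmin y) = radius s.
    by field; rewrite lt0r_neq0.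
  apply: le_trans (deviates_tail polP s supp cy _ _) _.
  - by rewrite divr_ge0 // ltW.
  (* Here 2 r <= 2 r zeta_a <= Delta_a <= 1. *)
  - by rewrite cr; nra.
  have l0 : 0 <= log_half R K s / s%:R by rewrite divr_ge0 //; lra.
  rewrite cr /radius sqr_sqrtr //.
  have -> : s%:R * (log_half R K s / s%:R) = log_half R K s by field; rewrite lt0r_neq0.
  by rewrite expRN /log_half lnK ?posrE.
apply: (@le_trans _ _ (\sum_(y : pavec B) 2 * (K%:R * s%:R ^+ 2 / 2)^-1)).
  rewrite big_mkcond /=; apply: ler_sum => y _; case: ifP => [|_]; first exact: tail.
  by rewrite mulr_ge0 // invr_ge0 ltW.
rewrite sumr_const (_ : #|_| = K); last by rewrite -card_pavec; exact: eq_card.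
by rewrite -[_ *+ K]mulr_natr le_eqVlt; apply/orP; left; apply/eqP; field; rewrite !lt0r_neq0.
Qed.

Definition plays a h : nat := count (fun r => r_arm r == a) h.

Lemma initial_plays a h : played pol h -> (size h <= #|arms B|)%N -> (plays a h <= 1)%N.
Proof.
have uniq_arms : played pol h -> (size h <= #|arms B|)%N -> uniq (map (@r_arm R B) h).
  elim=> // h' r ph IH pr; rewrite size_rcons map_rcons rcons_uniq => sh.
  have := proj2 polC h' (r_arm r) pr; rewrite sh => ->.
  by apply: IH; exact: ltnW.
move=> ph sh; have := uniq_arms ph sh; move=> /count_uniq_mem => /(_ a).
rewrite count_map => E; have -> : plays a h = (a \in map (@r_arm R B) h).
  by rewrite -E; apply: eq_count => r.
by case: (_ \in _).
Qed.

Lemma expect_plays a n : a \in arms B -> Delta a != 0 ->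
  iter n (step pol) (fun h => (plays a h)%:R) [::] <= (L a)%:R + 1.
Proof.
move=> aA D0; pose M := maxn (L a) #|arms B|.
have LL : (L2 a <= L a)%N by exact: leq_maxr.
have [M8 _ _] : [/\ (8 <= L a)%N, 2 <= log_half R K (L a) & L2_cond a (L a)].
  exact: L2_spec.
have early m : (m <= M)%N ->
    iter m (step pol) (fun h => (plays a h)%:R) [::] <= (L a)%:R.
  move=> mM; rewrite -[leRHS](iter_step_const polP m (L a)%:R [::]).
  apply: iter_step_le => //; first by constructor.
  move=> h ph; rewrite add0n => sh; rewrite ler_nat.
  (* Either only m <= L_a rounds have passed, or m <= |A| and a was played at most once. *)
  have [mL|mL] := leqP m (L a).
    by apply: leq_trans (count_size _ _) _; rewrite sh.
  apply: leq_trans (initial_plays a ph _) _; last by lia.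
  by rewrite sh; move: mM mL; rewrite /M; lia.
have [nM|Mn] := leqP n M; first by apply: le_trans (early n nM) _; rewrite lerDl.
(* The extra term -4/m makes the induction close: 4/(m+1)^2 <= 4/m - 4/(m+1). At the start, M >= 8
   keeps the subtracted term below 1. *)
have late m : (M <= m.+1)%N ->
    iter m.+1 (step pol) (fun h => (plays a h)%:R) [::] <= (L a)%:R + 1 - 4 / m%:R.
  elim: m => [|m IH] Mm; first by move: Mm M8; rewrite /M; lia.
  have m0 : (6 <= m)%N by move: Mm M8; rewrite /M; lia.
  have mR : 6 <= m%:R :> R by rewrite ler_nat.
  have [MSm|] := leqP M m.+1; last first.
    move=> mM; have {mM}Mm2 : M = m.+2 by apply/eqP; rewrite eqn_leq Mm.
    apply: le_trans (early _ _) _; first by rewrite Mm2.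
    rewrite -addrA lerDl subr_ge0 ler_pdivrMr ?ltr0n // mul1r ler_nat; lia.
  rewrite iterSr; apply: (@le_trans _ _ (iter m.+1 (step pol)
      (fun h => (plays a h)%:R + num_deviating m.+1 h) [::])).
    apply: iter_step_le => //; first by constructor.
    move=> h _; rewrite add0n => sh; rewrite step_count // lerD2l -sh.
    by apply: pol_le_bad => //; rewrite sh; move: MSm LL; rewrite /M; lia.
  rewrite iter_stepD.
  have Lm : (L2 a <= m.+1)%N by move: MSm LL; rewrite /M; lia.
  apply: le_trans (lerD (IH MSm) (expect_bad aA D0 Lm)) _.
  have : 4 / m.+1%:R ^+ 2 <= 4 / m%:R - 4 / m.+1%:R :> R.
    rewrite -subr_ge0 -[m.+1]addn1 natrD.
    have -> : 4 / m%:R - 4 / (m%:R + 1) - 4 / (m%:R + 1) ^+ 2 =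
        4 / (m%:R * (m%:R + 1) ^+ 2) :> R by field; rewrite !lt0r_neq0 //; lra.
    by rewrite divr_ge0 // mulr_ge0 // exprn_ge0 //; lra.
  by move: (4 / m%:R) (4 / m.+1%:R) (4 / m.+1%:R ^+ 2) => u v w; lra.
case: n Mn => // n Mn; apply: le_trans (late n (ltnW Mn)) _.
by rewrite lerBlDr lerDl divr_ge0.
Qed.

Lemma regret_plays h : played pol h ->
  (size h)%:R * mu_max B - \sum_(r <- h) mu (r_arm r) =
  \sum_(a in arms B | Delta a != 0) Delta a * (plays a h)%:R.
Proof.
move=> ph; rewrite -sum1_size natr_sum mulr_suml -sumrB.
under [RHS]eq_bigr do rewrite /plays -sum1_count natr_sum mulr_sumr.
under [RHS]eq_bigr do rewrite big_mkcond /=.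
rewrite exchange_big /=; apply: eq_big_seq => r rh.
have rA := played_arms polP ph rh.
rewrite mul1r -/(Delta _) -big_mkcondr /=.
have [D0|D0] := eqVneq (Delta (r_arm r)) 0.
  rewrite D0 big1 // => a /andP [/andP [_ Da] /eqP ra].
  by move: Da; rewrite -ra D0 eqxx.
rewrite (big_pred1 (r_arm r)) ?mulr1 // => a.
by rewrite inE [r_arm r == a]eq_sym; have [->|_] := eqVneq a (r_arm r); rewrite ?rA ?D0 ?andbF.
Qed.

Lemma expected_regretE T : expected_regret pol T =
  iter T (step pol) (fun h => T%:R * mu_max B - \sum_(r <- h) mu (r_arm r)) [::].
Proof.
rewrite -history_sum; apply: eq_bigr => h _; congr (_ * (_ - _)).
by rewrite /= big_tuple.
Qed.

Lemma expected_regret_le T : expected_regret pol T <=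
  \sum_(a in arms B | Delta a != 0) Delta a * ((L a)%:R + 1).
Proof.
rewrite expected_regretE.
apply: (@le_trans _ _ (iter T (step pol) (fun h =>
    \sum_(a in arms B | Delta a != 0) Delta a * (plays a h)%:R) [::])).
  apply: iter_step_le => //; first by constructor.
  by move=> h ph; rewrite add0n => <-; rewrite regret_plays.
rewrite iter_step_sum; apply: ler_sum => a /andP [aA D0].
by rewrite iter_stepZ ler_wpM2l ?Delta_ge0 // expect_plays.
Qed.

End Regret.

Theorem theorem4 (R : realType) (B : causal_bandit R)
  (hsupp : same_support B) (pol : policy B) (hpol : is_CUCB2 pol) (T : nat) :
  expected_regret pol T
    <= \sum_(a in arms B | Delta a != 0)
         Delta a * ((L a)%:R + 2 * pi ^+ 2 / 3).
Proof.
apply: le_trans (expected_regret_le hsupp hpol T) _.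
apply: ler_sum => a /andP [aA _]; rewrite ler_wpM2l ?Delta_ge0 // lerD2l.
(* From pi >= 2, 2 pi^2/3 >= 8/3 > 1. *)
have := pi_ge2 R; nra.
Qed.
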